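(* Let $\{x_k\}_{k\ge 0}$ be the sequence generated by the algorithm RDSE-SB described in the context, applied to $f$ under the standing assumptions listed there. Then $$\lim_{k\to\infty}\|\operatorname{grad} f(x_k)\|_{x_k}=0 .$$
   Context: Setting. $\mathcal M$ is a smooth manifold embedded in $\mathbb R^n$, equipped with a Riemannian metric $\langle\cdot,\cdot\rangle_x$ on $T_x\mathcal M$ depending smoothly on $x$, with norm $\|\cdot\|_x$ (subscripts often dropped). $\operatorname{dist}(x,y)$ is the length of the shortest geodesic connecting $x,y\in\mathcal M$. $\Gamma_x^y:T_x\mathcal M\to T_y\mathcal M$ is parallel transport with respect to the Levi-Civita connection along a (fixed) shortest geodesic from $x$ to $y$, the same geodesic reversed being used for $\Gamma_y^x$. For $v\in T_x\mathcal M$, $w\in T_y\mathcal M$, $\operatorname{dist}^*(v,w)=\|v-\Gamma_y^x w\|_x=\|w-\Gamma_x^y v\|_y$. $\operatorname{grad} f(x)\in T_x\mathcal M$ is the Riemannian gradient (equal to the orthogonal projection on $T_x\mathcal M$ of the Euclidean gradient for the metric induced from $\mathbb R^n$). Standing assumptions. (i) $f:\mathcal M\to\mathbb R$ is $C^1$ and bounded below. (ii) $R\in C^1(T\mathcal M,\mathcal M)$ is a retraction ($R(x,0)=x$ and the differential of $R(x,\cdot)$ at $0$ is the identity of $T_x\mathcal M$), there is $L_r>0$ with $\operatorname{dist}(R(x,d),x)\le L_r\|d\|_x$ for all $(x,d)\in T\mathcal M$, and there is $L>0$ with $f(R(x,d))\le f(x)+\langle\operatorname{grad} f(x),d\rangle_x+L\|d\|_x^2$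 for all $(x,d)\in T\mathcal M$. (iii) There is $L_f>0$ with $\operatorname{dist}^*(\operatorname{grad} f(x),\operatorname{grad} f(y))\le L_f\operatorname{dist}(x,y)$ for all $x,y\in\mathcal M$. (iv) There is $M_f>0$ with $\|\operatorname{grad} f(x)\|_x\le M_f$ for all $x\in\mathcal M$. (v) At each iteration $k$ one has a positive spanning basis $\{p_k^j\}_{j=1,\dots,K}$ of $T_{x_k}\mathcal M$ ($K$ fixed), and there are constants $B>0$, $\tau>0$, independent of $k$, with $\max_{1\le j\le K}\|p_k^j\|_{x_k}\le B$ and $\max_{1\le j\le K}\langle r,p_k^j\rangle_{x_k}\ge\tau\|r\|_{x_k}$ for all $k$ and all $r\in T_{x_k}\mathcal M$. (vi) There is a constant $L_\Gamma>0$ such that $\operatorname{dist}^*(p_l^j,p_m^j)\le L_\Gamma\operatorname{dist}(x_l,x_m)$ for all iterations $l,m$ and all $j\in\{1,\dots,K\}$. Linesearch procedure LS$(\alpha,x,d,\gamma,\gamma_1,\gamma_2)$, for $\alpha>0$, $x\in\mathcal M$, $d\in T_x\mathcal M$: if $f(R(x,\alpha d))>f(x)-\gamma\alpha^2$, return $(0,\gamma_1\alpha)$. Otherwise, while $f(R(x,\alpha d))\le f(x)-\gamma\alpha^2$, replace $\alpha$ by $\gamma_2\alpha$; when the loop ends return $(\alpha/\gamma_2,\alpha/\gamma_2)$. Algorithm RDSE-SB. Input: $x_0\in\mathcal M$, $\tilde\alpha_0^j>0$ for $j=1,\dots,K$, $\gamma>0$, $\gamma_1\in(0,1)$, $\gamma_2\ge1$.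 For $k=0,1,2,\dots$: take a positive spanning basis $\{p_k^j\}_{j=1,\dots,K}$ of $T_{x_k}\mathcal M$ as in (v), (vi); let $j(k)\in\{1,\dots,K\}$ be the index chosen cyclically, $j(k)=(k \bmod K)+1$; for $i\ne j(k)$ set $\alpha_k^i=\tilde\alpha_k^i$ and $\tilde\alpha_{k+1}^i=\tilde\alpha_k^i$; set $(\alpha_k^{j(k)},\tilde\alpha_{k+1}^{j(k)})=\mathrm{LS}(\tilde\alpha_k^{j(k)},x_k,p_k^{j(k)},\gamma,\gamma_1,\gamma_2)$; set $x_{k+1}=R(x_k,\alpha_k^{j(k)}p_k^{j(k)})$. That the algorithm generates $\{x_k\}$ presupposes that every call of LS terminates. *)

(* Defs.v *)
From HB Require Import structures.
From mathcomp Require Import all_boot all_order all_algebra.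
From mathcomp Require Import all_classical all_reals all_analysis.
Set Implicit Arguments.
Unset Strict Implicit.
Unset Printing Implicit Defensive.
Import Order.TTheory GRing.Theory Num.Theory.
Import numFieldNormedType.Exports.
Local Open Scope classical_set_scope.
Local Open Scope ring_scope.

Section Smoothness.
Variables (R : realType) (V W : normedModType R).

(* Meant for an open set [U] and a finite-dimensional [V]: there, [C^k.+1] is
   differentiability with all directional derivatives of class [C^k]. *)
Fixpoint Ck (k : nat) (U : set V) (h : V -> W) : Prop :=
  match k with
  | 0 => forall x, U x -> {for x, continuous h}
  | k'.+1 => (forall x, U x -> differentiable h x) /\
             (forall v : V, Ck k' U ('D_v h))
  end.

Definition smooth (U : set V) (h : V -> W) : Prop := forall k, Ck k U h.

End Smoothness.

Section Riemannian.
Variables (R : realType) (m n : nat).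

Implicit Types (M : set 'rV[R]_n) (phi : 'rV[R]_m -> 'rV[R]_n).
Implicit Types (U : set 'rV[R]_m).

(* The last clause says both that [phi @` U] is relatively open in [M] and that
   [phi] is a homeomorphism from [U] onto it for the subspace topology. *)
Definition local_param M phi U : Prop :=
  [/\ open U,
      smooth U phi,
      {in U &, injective phi},
      (forall u w, U u -> 'D_w phi u = 0 -> w = 0) &
      forall U', open U' -> U' `<=` U ->
        exists2 O : set 'rV[R]_n, open O & phi @` U' = M `&` O].

Definition embedded_manifold M : Prop :=
  forall x, M x -> exists phi U, local_param M phi U /\ (phi @` U) x.

Definition tangent M (x v : 'rV[R]_n) : Prop :=
  exists phi U u w,
    [/\ local_param M phi U, U u, phi u = x & v = 'D_w phi u].

(* [g x v w] is only meaningful for [x] in [M] and [v], [w] tangent at [x]. *)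
Implicit Types (g : 'rV[R]_n -> 'rV[R]_n -> 'rV[R]_n -> R).

Definition coord_vec (i : 'I_m) : 'rV[R]_m := delta_mx 0 i.

Definition gram g phi (u : 'rV[R]_m) : 'M[R]_m :=
  \matrix_(i, j) g (phi u) ('D_(coord_vec i) phi u) ('D_(coord_vec j) phi u).

Definition riemannian_metric M g : Prop :=
  [/\ forall x v w, M x -> tangent M x v -> tangent M x w -> g x v w = g x w v,
      forall x a v1 v2 w, M x ->
        tangent M x v1 -> tangent M x v2 -> tangent M x w ->
        g x (a *: v1 + v2) w = a * g x v1 w + g x v2 w,
      forall x v, M x -> tangent M x v -> v != 0 -> 0 < g x v v &
      forall phi U, local_param M phi U ->
        forall i j, smooth U (fun u => gram g phi u i j)].

Definition rnorm g (x v : 'rV[R]_n) : R := Num.sqrt (g x v v).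

(* [christoffel g phi u k i j] is the symbol Gamma^k_{ij} of the Levi-Civita
   connection in the local coordinates given by [phi]. *)
Definition christoffel g phi (u : 'rV[R]_m) (k i j : 'I_m) : R :=
  2^-1 * \sum_l invmx (gram g phi u) k l *
    ('D_(coord_vec i) (fun u' => gram g phi u' j l) u
     + 'D_(coord_vec j) (fun u' => gram g phi u' i l) u
     - 'D_(coord_vec l) (fun u' => gram g phi u' i j) u).

(* k-th coordinate of the covariant derivative, along the curve [phi \o u], of
   the vector field with coordinates [v]. *)
Definition covariant_derivative g phi (u v : R -> 'rV[R]_m) (s : R) (k : 'I_m)
    : R :=
  derive1 v s 0 k +
  \sum_i \sum_j christoffel g phi (u s) k i j * derive1 u s 0 i * v s 0 j.

(* Curves and fields are total functions on [R]; only a neighbourhood of [0, 1]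
   matters. Geodesics and parallel fields over [0, 1] always extend to such a
   neighbourhood, so two-sided derivatives are harmless at the endpoints. *)
Definition parallel M g (c V : R -> 'rV[R]_n) : Prop :=
  forall t : R, 0 <= t <= 1 ->
    M (c t) /\
    forall phi U, local_param M phi U -> (phi @` U) (c t) ->
      exists u v : R -> 'rV[R]_m, \forall s \near t,
        [/\ U (u s), c s = phi (u s) & V s = 'D_(v s) phi (u s)] /\
        [/\ derivable u s 1, derivable v s 1 &
            forall k, covariant_derivative g phi u v s k = 0].

Definition geodesic M g (x y : 'rV[R]_n) (c : R -> 'rV[R]_n) : Prop :=
  [/\ c 0 = x, c 1 = y & parallel M g c (derive1 c)].

Definition curve_length g (c : R -> 'rV[R]_n) : R :=
  (\int[@lebesgue_measure R]_(t in `[0%R, 1%R]) rnorm g (c t) (derive1 c t))%R.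

Definition geodesic_dist M g (x y : 'rV[R]_n) : R :=
  inf [set curve_length g c | c in geodesic M g x y].

Definition shortest_geodesics M g
    (geo : 'rV[R]_n -> 'rV[R]_n -> R -> 'rV[R]_n) : Prop :=
  forall x y, M x -> M y ->
    [/\ geodesic M g x y (geo x y),
        curve_length g (geo x y) = geodesic_dist M g x y,
        (forall c, geodesic M g x y c ->
           curve_length g (geo x y) <= curve_length g c) &
        forall t, 0 <= t <= 1 -> geo y x t = geo x y (1 - t)].

(* [G x y] is the transport from the tangent space at [x] to the one at [y]. *)
Definition parallel_transport M g
    (geo : 'rV[R]_n -> 'rV[R]_n -> R -> 'rV[R]_n)
    (G : 'rV[R]_n -> 'rV[R]_n -> 'rV[R]_n -> 'rV[R]_n) : Prop :=
  forall x y v, M x -> M y -> tangent M x v ->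
    exists V : R -> 'rV[R]_n,
      [/\ parallel M g (geo x y) V, V 0 = v & V 1 = G x y v].

Definition dist_star g (G : 'rV[R]_n -> 'rV[R]_n -> 'rV[R]_n -> 'rV[R]_n)
    (x v y w : 'rV[R]_n) : R :=
  rnorm g x (v - G y x w).

Definition C1_on_manifold M (f : 'rV[R]_n -> R) : Prop :=
  forall phi U, local_param M phi U -> Ck 1 U (f \o phi).

Definition riemannian_gradient M g (f : 'rV[R]_n -> R)
    (gradf : 'rV[R]_n -> 'rV[R]_n) : Prop :=
  forall x, M x -> tangent M x (gradf x) /\
    forall phi U u, local_param M phi U -> U u -> phi u = x ->
      forall w, g x (gradf x) ('D_w phi u) = 'D_w (f \o phi) u.

(* [C^1] on the tangent bundle is expressed in the bundle coordinates
   [(u, w) |-> (phi u, 'D_w phi u)]. *)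
Definition retraction M (Rt : 'rV[R]_n -> 'rV[R]_n -> 'rV[R]_n) : Prop :=
  [/\ forall x d, M x -> tangent M x d -> M (Rt x d),
      forall phi U, local_param M phi U ->
        Ck 1 [set z : 'rV[R]_m * 'rV[R]_m | U z.1]
          (fun z => Rt (phi z.1) ('D_(z.2) phi z.1)),
      forall x, M x -> Rt x 0 = x &
      forall x d, M x -> tangent M x d ->
        is_derive (0 : R) 1 (fun t : R => Rt x (t *: d)) d].

Definition positive_spanning M (x : 'rV[R]_n) (K : nat)
    (q : 'I_K -> 'rV[R]_n) : Prop :=
  (forall j, tangent M x (q j)) /\
  (forall v, tangent M x v ->
     exists2 a : 'I_K -> R, forall j, 0 <= a j & v = \sum_j a j *: q j).

End Riemannian.

Arguments embedded_manifold {R} m {n} M : assert.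
Arguments tangent {R} m {n} M x v : assert.
Arguments riemannian_metric {R} m {n} M g : assert.
Arguments parallel {R} m {n} M g c V : assert.
Arguments geodesic {R} m {n} M g x y c : assert.
Arguments geodesic_dist {R} m {n} M g x y : assert.
Arguments shortest_geodesics {R} m {n} M g geo : assert.
Arguments parallel_transport {R} m {n} M g geo G : assert.
Arguments C1_on_manifold {R} m {n} M f : assert.
Arguments riemannian_gradient {R} m {n} M g f gradf : assert.
Arguments retraction {R} m {n} M Rt : assert.
Arguments positive_spanning {R} m {n} M x {K} q : assert.

Section Algorithm.
Variables (R : realType) (n : nat).
Variables (f : 'rV[R]_n -> R) (Rt : 'rV[R]_n -> 'rV[R]_n -> 'rV[R]_n).
Variables (gamma gamma1 gamma2 : R).

Definition sufficient_decrease (x d : 'rV[R]_n) (alpha : R) : bool :=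
  f (Rt x (alpha *: d)) <= f x - gamma * alpha ^+ 2.

(* [extrapolation x d a b]: the while loop, entered with the value [a], ends
   with the value [b]. Non-terminating runs are related to no [b]. *)
Inductive extrapolation (x d : 'rV[R]_n) : R -> R -> Prop :=
| extrapolation_stop a :
    ~~ sufficient_decrease x d a -> extrapolation x d a a
| extrapolation_step a b :
    sufficient_decrease x d a -> extrapolation x d (gamma2 * a) b ->
    extrapolation x d a b.

Inductive linesearch (alpha : R) (x d : 'rV[R]_n) : R * R -> Prop :=
| linesearch_fail :
    ~~ sufficient_decrease x d alpha ->
    linesearch alpha x d (0, gamma1 * alpha)
| linesearch_success b :
    sufficient_decrease x d alpha -> extrapolation x d alpha b ->
    linesearch alpha x d (b / gamma2, b / gamma2).

(* Directions are indexed from 0, so the cyclic index is [k %% K]. *)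
Definition cyclic_index (K : nat) (hK : (0 < K)%N) (k : nat) : 'I_K :=
  Ordinal (ltn_pmod k hK).

(* [alpha k i] and [talpha k i] are the stepsizes alpha_k^i and
   \tilde alpha_k^i. *)
Definition RDSE_SB (M : set 'rV[R]_n) (K : nat) (hK : (0 < K)%N)
    (x : nat -> 'rV[R]_n) (p : nat -> 'I_K -> 'rV[R]_n)
    (alpha talpha : nat -> 'I_K -> R) : Prop :=
  [/\ M (x 0%N),
      forall i, 0 < talpha 0%N i,
      forall k i, i != cyclic_index hK k ->
        alpha k i = talpha k i /\ talpha k.+1 i = talpha k i,
      forall k, let j := cyclic_index hK k in
        linesearch (talpha k j) (x k) (p k j) (alpha k j, talpha k.+1 j) &
      forall k, let j := cyclic_index hK k in
        x k.+1 = Rt (x k) (alpha k j *: p k j)].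

End Algorithm.

(* Main.v *)
Require Import Defs.
From HB Require Import structures.
From mathcomp Require Import all_boot all_order all_algebra.
From mathcomp Require Import all_classical all_reals all_analysis.
From mathcomp Require Import ring lra.
Set Implicit Arguments.
Unset Strict Implicit.
Unset Printing Implicit Defensive.
Import Order.TTheory GRing.Theory Num.Theory.
Import numFieldNormedType.Exports.
Local Open Scope classical_set_scope.
Local Open Scope ring_scope.

(** Every poll satisfies f(x_{k+1}) <= f(x_k) - gamma alpha_k^2, so the step
    alpha_k actually taken tends to 0; the tentative stepsize of a direction
    either equals that step or is shrunk by gamma1, so it tends to 0 as well.
    A rejected trial point (there is one in every call of the linesearch) bounds
    -<grad f(x_k), p_k^j(k)> by a multiple of the new tentative stepsize.
    Parallel transport is an isometry, so <grad f(x_k), p_k^j> changes from one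
    iterate to the next by at most a multiple of dist(x_{k+1}, x_k), hence of
    alpha_k. Comparing consecutive iterates only, at most K of them, carries the
    bound from the iteration that polls direction j to iteration k, and no
    triangle inequality for the distance is needed; the positive spanning
    condition then controls the gradient. *)

(** * Boundedness of matrix multiplication *)

Section MatrixNorm.
Variable R : realType.

Lemma mulmx_norm_bound (m n : nat) (A : 'M[R]_(m, n)) :
  exists2 C : R, 0 < C & forall v : 'rV[R]_m, `|v *m A| <= C * `|v|.
Proof.
(* The norm is the maximum of the entries, so a sum of [m] products costs a factor [m]; the [+ 1]
   keeps the constant positive when [A] vanishes. *)
exists (m%:R * `|A| + 1) => [|v]; first by rewrite ltr_wpDl// mulr_ge0.
rewrite [leLHS]/Num.Def.normr/= mx_normrE.
rewrite bigmax_le ?mulr_ge0 ?addr_ge0 ?mulr_ge0//= => -[i j] _ /=.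
have entry (p q : nat) (N : 'M[R]_(p, q)) a b : `|N a b| <= `|N|.
  by rewrite [leRHS]/Num.Def.normr/= mx_normrE (le_bigmax _ _ (a, b)).
rewrite mxE (le_trans (ler_norm_sum _ _ _))//.
apply: (@le_trans _ _ (\sum_(k < m) `|A| * `|v|)).
  by apply: ler_sum => k _; rewrite normrM mulrC ler_pM.
by rewrite sumr_const card_ord mulrDl mul1r -mulrA mulr_natl lerDl.
Qed.

End MatrixNorm.

(** * Tangent vectors read in one chart, and linearity of the tangent space *)

Section Tangent.
Variables (R : realType) (m n : nat) (M : set 'rV[R]_n).
Implicit Types (phi : 'rV[R]_m -> 'rV[R]_n) (U : set 'rV[R]_m).

Lemma local_param_differentiable phi U u :
  local_param M phi U -> U u -> differentiable phi u.
Proof. by case=> _ /(_ 1%N) [d _] _ _ _ Uu; exact: d. Qed.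

Lemma local_param_in phi U u : local_param M phi U -> U u -> M (phi u).
Proof.
move=> [oU _ _ _ op] Uu; have [N _ UN] := op U oU (@subset_refl _ _).
by have [] : (M `&` N) (phi u) by rewrite -UN; exists u.
Qed.

Lemma derive_lin phi U u (a : R) v w : local_param M phi U -> U u ->
  'D_(a *: v + w) phi u = a *: 'D_v phi u + 'D_w phi u.
Proof.
move=> lp Uu; have d := local_param_differentiable lp Uu.
by rewrite !deriveE// linearP.
Qed.

Lemma jacobian_row_free phi U u :
  local_param M phi U -> U u -> row_free (jacobian phi u).
Proof.
move=> lp Uu; have d := local_param_differentiable lp Uu.
apply: inj_row_free => v; rewrite -deriveEjacobian//.
by case: lp => _ _ _ inj _; exact: inj.
Qed.

(* The charts are only compared to first order: near [x], the points of a curve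
   in [M] through [x] are images under [phi] of parameters at distance
   [O(s)] from [u], so its velocity lies in the closed range of ['d phi u]. *)
Lemma tangent_in_chart phi U u v : local_param M phi U -> U u ->
  tangent m M (phi u) v -> exists w, v = 'D_w phi u.
Proof.
move=> lp Uu [psi [U0 [u0 [w0 [lp0 U0u0 psiu0 vE]]]]].
have dphi := local_param_differentiable lp Uu.
have dpsi := local_param_differentiable lp0 U0u0.
set J := jacobian phi u.
set P := pinvmx J.
have JP : J *m P = 1%:M by apply/mulmxVp/(jacobian_row_free lp).
exists (v *m P); rewrite deriveEjacobian// -/J.
apply/eqP; rewrite -subr_eq0 -normr_eq0; apply/eqP.
have [CP CP0 boundP] := mulmx_norm_bound P.
(* [P] recovers coordinates from vectors in the row space of [J], and [Q] kills that row space, so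
   membership of [v] amounts to [v *m Q = 0]. *)
set Q : 'M[R]_n := 1%:M - P *m J.
have JQ : J *m Q = 0 by rewrite /Q mulmxBr mulmx1 mulmxA JP mul1mx subrr.
have -> : v - v *m P *m J = v *m Q.
  by rewrite /Q mulmxBr mulmx1 -[v *m P *m J]mulmxA.
have [CQ CQ0 boundQ] := mulmx_norm_bound Q.
pose gam (s : R) := psi (s *: w0 + u0).
have chart_near (e : R) : 0 < e -> \forall s \near (0 : R)^',
    exists h, `|gam s - phi u - h *m J| <= e * `|h|.
  move=> e0.
  have est : \forall h \near (0 : 'rV[R]_m),
      `|phi (h + u) - phi u - h *m J| <= e * `|h|.
    have /eqaddoP /(_ e e0) := diff_locally dphi.
    apply: filter_app; near=> h.
    by rewrite !fctE /= /cst opprD addrA mul_rV_lin1.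
  (* [A] collects the parameters satisfying the first-order estimate. The image of its interior is
     relatively open in [M], so it contains the curve for small [s]. *)
  pose A := [set z | U z /\
    `|phi z - phi u - (z - u) *m J| <= e * `|z - u|].
  have Au : A^° u.
    apply: filterI; first by apply: open_nbhs_nbhs; split=> //; case: lp.
    have zu : z - u @[z --> u] --> (0 : 'rV[R]_m).
      exact: ((@subr_cvg0 _ _ _ (nbhs u) (nbhs_filter u) id u).2 (@cvg_id _ _)).
    apply: (@filterS _ (nbhs u) (nbhs_filter u) _ _ _ (zu _ est)) => z /=.
    by rewrite subrK.
  have AU : A^° `<=` A by exact: interior_subset.
  have [N oN BN] : exists2 N, open N & phi @` A^° = M `&` N.
    by case: lp => _ _ _ _; apply; [exact: open_interior|move=> z /AU[]].
  have Nu : N (psi u0).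
    by have [] : (M `&` N) (psi u0) by rewrite psiu0 -BN; exists u.
  have line : s *: w0 + u0 @[s --> (0 : R)] --> u0.
    rewrite -[X in _ --> X]add0r -[X in _ --> X + _](scale0r w0).
    by apply: cvgD; [exact: scalel_continuous|exact: cvg_cst].
  have U0n : \forall s \near (0 : R), U0 (s *: w0 + u0).
    by apply: line; apply: open_nbhs_nbhs; split=> //; case: lp0.
  have Nn : \forall s \near (0 : R), N (gam s).
    have cpsi := differentiable_continuous dpsi.
    apply: (@continuous_cvg _ _ _ _ _ _ psi _ cpsi line).
    exact: open_nbhs_nbhs.
  apply: nbhs_dnbhs; apply: filterS2 U0n Nn => s U0s Ns.
  have : (M `&` N) (gam s) by split=> //; exact: local_param_in lp0 _.
  by rewrite -BN => -[z /AU[_ zle] <-]; exists (z - u).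
have quot : (fun s : R => s^-1 *: (gam s - phi u)) @ 0^' --> v.
  by rewrite vE -psiu0; exact: (@diff_derivable _ _ _ _ _ w0 dpsi).
pose C := CQ * (2 * CP * (`|v| + 1)) + CQ.
have small (e : R) : 0 < e -> 2 * CP * e <= 1 -> `|v *m Q| <= C * e.
  move=> e0 e1.
  have nq : \forall s \near (0 : R)^',
      `|v - s^-1 *: (gam s - phi u)| <= Num.min e 1.
    by move/cvgrPdist_le: quot; apply; rewrite lt_min e0/=.
  have n0 : \forall s \near (0 : R)^', s != 0 by exact: nbhs_dnbhs_neq.
  have [s [[s0 qs] [h hle]]] :=
    filter_ex (filterI (filterI n0 nq) (chart_near e e0)).
  rewrite /= le_min in qs; have /andP[qe q1] := qs.
  set G := gam s - phi u in qe q1 hle.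
  have GJh : (G - (G - h *m J)) *m P = h.
    by rewrite subKr -[LHS]mulmxA JP mulmx1.
  (* Applying [P] gives a bound on [h] that still contains [CP * e] times its own norm; as
     [2 * CP * e <= 1], half of the left side absorbs that term. *)
  have hG : `|h| <= 2 * CP * `|G|.
    have : `|h| <= CP * (`|G| + e * `|h|).
      rewrite -[in leLHS]GJh (le_trans (boundP _))// ler_pM2l//.
      by rewrite (le_trans (ler_normB _ _))// lerD2l.
    have : CP * e * `|h| * 2 <= `|h| by have := ler_wpM2r (normr_ge0 h) e1; lra.
    lra.
  (* Only the Taylor remainder survives [Q]; this is the source of the factor [e]. *)
  have GQ : G *m Q = (G - h *m J) *m Q.
    by rewrite [RHS]mulmxBl -[h *m J *m Q]mulmxA JQ mulmx0 subr0.
  have qQ : `|(s^-1 *: G) *m Q| <= CQ * e * (2 * CP) * `|s^-1 *: G|.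
    rewrite -scalemxAl !normrZ [leRHS]mulrCA ler_wpM2l//.
    rewrite GQ (le_trans (boundQ _))//.
    suff : CQ * `|G - h *m J| <= CQ * (e * (2 * CP * `|G|)) by lra.
    by rewrite ler_pM2l// (le_trans hle)// ler_pM2l.
  have qn : `|s^-1 *: G| <= `|v| + 1.
    rewrite -[s^-1 *: G](subKr v) (le_trans (ler_normB _ _))//; lra.
  rewrite -[v in leLHS](subrK (s^-1 *: G)) mulmxDl (le_trans (ler_normD _ _))//.
  rewrite /C mulrDl addrC lerD//.
    have := ler_wpM2l (ltW (mulr_gt0 (mulr_gt0 CQ0 CP0) e0)) qn.
    by have := qQ; lra.
  by rewrite (le_trans (boundQ _))// ler_pM2l.
have C0 : 0 < C by rewrite ltr_wpDl// !mulr_ge0// ?addr_ge0// ltW.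
apply/eqP; rewrite eq_le normr_ge0 andbT; apply/ler_addgt0Pr => e e0.
pose e' := Num.min (e / C) (2 * CP)^-1.
have CP20 : 0 < 2 * CP by rewrite mulr_gt0.
have e'0 : 0 < e' by rewrite lt_min divr_gt0// invr_gt0.
rewrite add0r (le_trans (small e' e'0 _))//.
  by rewrite mulrC -ler_pdivlMr// mul1r ge_min lexx orbT.
by rewrite mulrC -ler_pdivlMr// ge_min lexx.
Unshelve. all: by end_near. Qed.

Lemma tangent_linear x (a : R) v w : tangent m M x v -> tangent m M x w ->
  tangent m M x (a *: v + w).
Proof.
move=> [phi [U [u [v' [lp Uu <- ->]]]]] /(tangent_in_chart lp Uu)[w' ->].
by exists phi, U, u, (a *: v' + w'); split=> //; rewrite (derive_lin _ _ _ lp).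
Qed.

Lemma tangent0 x : embedded_manifold m M -> M x -> tangent m M x 0.
Proof.
move=> hM /hM[phi [U [lp [u Uu <-]]]].
by exists phi, U, u, 0; split=> //; rewrite derive0.
Qed.

Lemma tangentZ x (a : R) v : tangent m M x v -> tangent m M x (a *: v).
Proof.
move=> tv; have t0 := tangent_linear (-1) tv tv.
by have := tangent_linear a tv t0; rewrite scaleN1r addNr addr0.
Qed.

Lemma tangentB x v w : tangent m M x v -> tangent m M x w ->
  tangent m M x (v - w).
Proof. by move=> tv tw; rewrite addrC -scaleN1r; exact: tangent_linear. Qed.
End Tangent.

(** The metric is linear only on tangent vectors. Writing these as ['D_v phi u] makes each slot a
    function of [v] that is linear on the whole parameter space, to which this expansion applies. *)
Lemma additive_delta_expand (R : realType) (m : nat) (h : 'rV[R]_m -> R) v :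
  (forall a v w, h (a *: v + w) = a * h v + h w) ->
  h v = \sum_i v 0 i * h (coord_vec R i).
Proof.
move=> hlin; have h0 : h 0 = 0.
  by have := hlin (-1) 0 0; rewrite scaler0 addr0 mulN1r addNr.
rewrite {1}[v]row_sum_delta.
by elim/big_rec2: _ => // i y w _ <-; rewrite hlin.
Qed.

(** * Pointwise algebra of the metric, Gram matrices and Christoffel symbols *)

Section Metric.
Variables (R : realType) (m n : nat) (M : set 'rV[R]_n).
Variable g : 'rV[R]_n -> 'rV[R]_n -> 'rV[R]_n -> R.
Hypotheses (hM : embedded_manifold m M) (hg : riemannian_metric m M g).
Implicit Types (phi : 'rV[R]_m -> 'rV[R]_n) (U : set 'rV[R]_m).

Lemma tangent_derive phi U u w :
  local_param M phi U -> U u -> tangent m M (phi u) ('D_w phi u).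
Proof. by move=> lp Uu; exists phi, U, u, w. Qed.

Lemma metric_sym x v w : M x -> tangent m M x v -> tangent m M x w ->
  g x v w = g x w v.
Proof. by case: hg => + _ _ _; apply. Qed.

Lemma metric_linearl x (a : R) v1 v2 w : M x -> tangent m M x v1 ->
  tangent m M x v2 -> tangent m M x w ->
  g x (a *: v1 + v2) w = a * g x v1 w + g x v2 w.
Proof. by case: hg => _ + _ _; apply. Qed.

Lemma metric0l x w : M x -> tangent m M x w -> g x 0 w = 0.
Proof.
move=> Mx tw; have t0 := tangent0 hM Mx.
by have := metric_linearl (-1) Mx t0 t0 tw; rewrite scaler0 addr0 mulN1r addNr.
Qed.

Lemma metricZl x (a : R) v w : M x -> tangent m M x v -> tangent m M x w ->
  g x (a *: v) w = a * g x v w.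
Proof.
move=> Mx tv tw; rewrite -[a *: v]addr0 metric_linearl//; last exact: tangent0.
by rewrite metric0l// addr0.
Qed.

Lemma metricZr x (a : R) v w : M x -> tangent m M x v -> tangent m M x w ->
  g x v (a *: w) = a * g x v w.
Proof.
move=> Mx tv tw; rewrite metric_sym//; last exact: tangentZ.
by rewrite metricZl// [in RHS]metric_sym.
Qed.

Lemma metricBl x v1 v2 w : M x -> tangent m M x v1 -> tangent m M x v2 ->
  tangent m M x w -> g x (v1 - v2) w = g x v1 w - g x v2 w.
Proof.
by move=> Mx t1 t2 tw; rewrite addrC -scaleN1r metric_linearl// mulN1r addrC.
Qed.

Lemma metricBr x v1 v2 w : M x -> tangent m M x v1 -> tangent m M x v2 ->
  tangent m M x w -> g x w (v1 - v2) = g x w v1 - g x w v2.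
Proof.
move=> Mx t1 t2 tw; rewrite metric_sym//; last exact: tangentB.
by rewrite metricBl// (metric_sym Mx t1)// (metric_sym Mx t2).
Qed.

Lemma metric_gt0 x v : M x -> tangent m M x v -> v != 0 -> 0 < g x v v.
Proof. by case: hg => _ _ + _; apply. Qed.

Lemma metric_ge0 x v : M x -> tangent m M x v -> 0 <= g x v v.
Proof.
move=> Mx tv; have [->|v0] := eqVneq v 0; last exact/ltW/metric_gt0.
by rewrite metric0l//; exact: tangent0.
Qed.

Lemma rnormZ x (a : R) v : M x -> tangent m M x v ->
  rnorm g x (a *: v) = `|a| * rnorm g x v.
Proof.
move=> Mx tv; rewrite /rnorm metricZl ?metricZr//; last exact: tangentZ.
by rewrite mulrA -expr2 sqrtrM ?sqr_ge0// sqrtr_sqr.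
Qed.

Lemma cauchy_schwarz x v w : M x -> tangent m M x v -> tangent m M x w ->
  `|g x v w| <= rnorm g x v * rnorm g x w.
Proof.
move=> Mx tv tw; rewrite -sqrtrM ?metric_ge0// -sqrtr_sqr ler_sqrt; last first.
  by rewrite mulr_ge0// metric_ge0.
have [->|w0] := eqVneq w 0.
  rewrite metric_sym//; last exact: tangent0.
  by rewrite metric0l// metric0l ?mulr0 ?expr0n//; exact: tangent0.
have gw := metric_gt0 Mx tw w0.
(* [a *: w] is the orthogonal projection of [v] on [w]; the inequality says that the residual has
   nonnegative square. *)
set a := g x v w / g x w w.
have taw := tangentZ a tw.
have := metric_ge0 Mx (tangentB tv taw).
rewrite (metricBl Mx tv taw (tangentB tv taw)) !(metricBr Mx tv taw)//.
rewrite (metricZr a Mx tv tw) (metricZr a Mx taw tw) !(metricZl a Mx tw)//.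
rewrite (metric_sym Mx tw tv).
have aE : a * g x w w = g x v w by rewrite divfK// gt_eqF.
rewrite aE subrr subr0 => h; rewrite -aE in h *.
have -> : (a * g x w w) ^+ 2 = (a * (a * g x w w)) * g x w w by ring.
by rewrite ler_pM2r// -subr_ge0.
Qed.

Lemma gram_form phi U u v w : local_param M phi U -> U u ->
  g (phi u) ('D_v phi u) ('D_w phi u) =
  \sum_i \sum_j v 0 i * gram g phi u i j * w 0 j.
Proof.
move=> lp Uu; have Mx := local_param_in lp Uu.
have t z : tangent m M (phi u) ('D_z phi u) by exact: tangent_derive lp Uu.
rewrite (additive_delta_expand
  (h := fun v => g (phi u) ('D_v phi u) ('D_w phi u)));
  last by move=> a z1 z2; rewrite (derive_lin _ _ _ lp Uu) metric_linearl.
apply: eq_bigr => i _; rewrite metric_sym//.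
rewrite (additive_delta_expand
  (h := fun w => g (phi u) ('D_w phi u) ('D_(coord_vec R i) phi u)));
  last by move=> a z1 z2; rewrite (derive_lin _ _ _ lp Uu) metric_linearl.
rewrite mulr_sumr; apply: eq_bigr => j _.
by rewrite metric_sym// mxE mulrA mulrAC.
Qed.

Lemma gram_sym phi U u i j : local_param M phi U -> U u ->
  gram g phi u i j = gram g phi u j i.
Proof.
move=> lp Uu; rewrite !mxE metric_sym//; first exact: local_param_in lp Uu.
all: exact: tangent_derive lp Uu.
Qed.

(** A nonzero kernel vector would have, by the immersion condition, a nonzero image under the
    differential, yet a vanishing square for the metric. *)
Lemma gram_unit phi U u : local_param M phi U -> U u ->
  gram g phi u \in unitmx.
Proof.
move=> lp Uu; have Mx := local_param_in lp Uu.
rewrite -row_free_unit; apply: inj_row_free => v vG.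
apply: contrapT => /eqP v0.
have tv : tangent m M (phi u) ('D_v phi u) by exact: tangent_derive lp Uu.
have Dv0 : 'D_v phi u != 0.
  by apply: contra_neq v0; case: lp => _ _ _ inj _; exact: inj.
have := metric_gt0 Mx tv Dv0; rewrite (gram_form _ _ lp Uu).
rewrite exchange_big/= big1 ?ltxx// => j _.
rewrite -mulr_suml; move/matrixP/(_ 0 j): vG; rewrite !mxE.
by move=> ->; rewrite mul0r.
Qed.

Lemma gram_differentiable phi U u i j : local_param M phi U -> U u ->
  differentiable (fun u => gram g phi u i j) u.
Proof. by case: hg => _ _ _ + lp => /(_ _ _ lp i j 1%N)[+ _]; apply. Qed.

(** Lowering the index cancels the inverse Gram matrix and leaves the symbols of the first kind, the
    form in which metric compatibility is checked. *)
Lemma christoffel_lower phi U u a b j : local_param M phi U -> U u ->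
  \sum_k gram g phi u j k * christoffel g phi u k a b =
  2^-1 * ('D_(coord_vec R a) (fun u' => gram g phi u' b j) u
     + 'D_(coord_vec R b) (fun u' => gram g phi u' a j) u
     - 'D_(coord_vec R j) (fun u' => gram g phi u' a b) u).
Proof.
move=> lp Uu; rewrite /christoffel.
pose X l := 'D_(coord_vec R a) (fun u' => gram g phi u' b l) u
     + 'D_(coord_vec R b) (fun u' => gram g phi u' a l) u
     - 'D_(coord_vec R l) (fun u' => gram g phi u' a b) u.
rewrite -/(X j).
under eq_bigr do rewrite mulrCA mulr_sumr.
rewrite -mulr_sumr exchange_big/=; congr (_ * _).
transitivity (\sum_l (gram g phi u *m invmx (gram g phi u)) j l * X l).
  by apply: eq_bigr => l _; rewrite mxE mulr_suml; apply: eq_bigr => k _;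
    rewrite mulrA.
rewrite mulmxV ?(gram_unit lp)// (bigD1 j)//= mxE eqxx mul1r.
rewrite big1 ?addr0// => l lj.
by rewrite mxE eq_sym (negbTE lj) mul0r.
Qed.
End Metric.

(** * Compatibility of the connection with the metric, and isometry of parallel transport *)

Section Parallel.
Variables (R : realType) (m n : nat) (M : set 'rV[R]_n).
Variable g : 'rV[R]_n -> 'rV[R]_n -> 'rV[R]_n -> R.
Hypotheses (hM : embedded_manifold m M) (hg : riemannian_metric m M g).
Implicit Types (phi : 'rV[R]_m -> 'rV[R]_n) (U : set 'rV[R]_m).

Lemma is_derive_big (I : finType) (h : I -> R -> R) (t : R) (dh : I -> R) :
  (forall i, is_derive t 1 (h i) (dh i)) ->
  is_derive t 1 (fun s => \sum_i h i s) (\sum_i dh i).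
Proof.
move=> hd; have -> : (fun s => \sum_i h i s) = \sum_i h i.
  by apply/funext => s; rewrite fct_sumE.
elim/big_rec2: _ => [|i df f _ fd]; first exact: is_derive_cst.
exact: is_deriveD.
Qed.

Lemma is_derive_gram phi U (u : R -> 'rV[R]_m) t i j :
  local_param M phi U -> U (u t) -> derivable u t 1 ->
  is_derive t 1 (fun s => gram g phi (u s) i j)
    (\sum_a derive1 u t 0 a
       * 'D_(coord_vec R a) (fun z => gram g phi z i j) (u t)).
Proof.
move=> lp Uu /derivable1_diffP du.
have dG := gram_differentiable hg i j lp Uu.
pose G z := gram g phi z i j.
have dGu : differentiable (G \o u) t by exact: differentiable_comp.
apply: DeriveDef; first exact: diff_derivable dGu.
rewrite -[LHS]/('D_1 (G \o u) t) deriveE// diff_comp//= -derive1E'//.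
rewrite (additive_delta_expand (h := fun w => 'd G (u t) w)); last first.
  by move=> a v w; rewrite linearP.
by apply: eq_bigr => a _; rewrite -deriveE.
Qed.

Lemma is_derive_coord p (v : R -> 'rV[R]_p) t i : derivable v t 1 ->
  is_derive t 1 (fun s => v s 0 i) (derive1 v t 0 i).
Proof.
move=> dv; apply: DeriveDef; first exact: (derivable_mxP _ _ _).1 dv 0 i.
by rewrite derive1E derive_mx// mxE.
Qed.

(* [D a i j] stands for the [a]-th partial derivative of the metric coefficient
   [G i j], [u'] for the velocity of the curve, and [v'], [w'] for the
   derivatives of the coordinates of two parallel fields: the sum is the
   derivative of their inner product. *)
Lemma metric_compat (G : 'M[R]_m) (D : 'I_m -> 'I_m -> 'I_m -> R)
    (Gam : 'I_m -> 'I_m -> 'I_m -> R) (u' v v' w w' : 'I_m -> R) :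
  (forall i j, G i j = G j i) -> (forall a i j, D a i j = D a j i) ->
  (forall a b j, \sum_k G j k * Gam k a b =
     2^-1 * (D a b j + D b a j - D j a b)) ->
  (forall k, v' k + \sum_a \sum_b Gam k a b * u' a * v b = 0) ->
  (forall k, w' k + \sum_a \sum_b Gam k a b * u' a * w b = 0) ->
  \sum_i \sum_j (v' i * G i j * w j + v i * (\sum_a u' a * D a i j) * w j
                 + v i * G i j * w' j) = 0.
Proof.
move=> Gs Ds GamE vE wE.
(* Christoffel symbols of the first kind; [lower] uses them to eliminate the derivatives of the two
   fields. *)
pose C a b j := 2^-1 * (D a b j + D b a j - D j a b).
have lower (z z' : 'I_m -> R) :
    (forall k, z' k + \sum_a \sum_b Gam k a b * u' a * z b = 0) ->
    forall j, \sum_k G j k * z' k = - \sum_a \sum_b C a b j * u' a * z b.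
  move=> zE j; apply/eqP; rewrite -addr_eq0; apply/eqP.
  transitivity (\sum_k G j k * (z' k + \sum_a \sum_b Gam k a b * u' a * z b)).
    under [RHS]eq_bigr do rewrite mulrDr.
    rewrite big_split/=; congr (_ + _).
    under [RHS]eq_bigr do rewrite mulr_sumr.
    rewrite [RHS]exchange_big/=; apply: eq_bigr => a _.
    under [RHS]eq_bigr do rewrite mulr_sumr.
    rewrite [RHS]exchange_big/=; apply: eq_bigr => b _.
    rewrite /C -GamE -!mulrA mulr_suml; apply: eq_bigr => k _.
    by rewrite !mulrA.
  by apply: big1 => k _; rewrite zE mulr0.
have S1 : \sum_i \sum_j v' i * G i j * w j =
    - \sum_i \sum_j \sum_a C a i j * u' a * v i * w j.
  rewrite exchange_big/= [in RHS]exchange_big/= -sumrN; apply: eq_bigr => j _.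
  rewrite -mulr_suml; under [X in X * _]eq_bigr => k _ do rewrite mulrC Gs.
  rewrite (lower v)// mulNr exchange_big/= mulr_suml; congr (- _).
  by apply: eq_bigr => i _; rewrite mulr_suml.
have S3 : \sum_i \sum_j v i * G i j * w' j =
    - \sum_i \sum_j \sum_a C a j i * u' a * v i * w j.
  rewrite -sumrN; apply: eq_bigr => i _.
  under [LHS]eq_bigr => j _ do rewrite -mulrA.
  rewrite -mulr_sumr (lower w)// mulrN.
  rewrite exchange_big/= mulr_sumr; congr (- _).
  apply: eq_bigr => j _; rewrite mulr_sumr; apply: eq_bigr => a _; ring.
(* This is the identity [D a i j = C a i j + C a j i]: the remaining partial derivatives cancel by
   symmetry of the metric. *)
have S2 : \sum_i \sum_j v i * (\sum_a u' a * D a i j) * w j =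
    \sum_i \sum_j \sum_a (C a i j + C a j i) * u' a * v i * w j.
  apply: eq_bigr => i _; apply: eq_bigr => j _.
  rewrite mulr_sumr mulr_suml; apply: eq_bigr => a _.
  by rewrite /C (Ds a j i) (Ds i a j) (Ds j a i); field.
under eq_bigr do rewrite !big_split/=.
rewrite !big_split/= S1 S2 S3 -sumrN -[X in _ + X]sumrN -!big_split/=.
apply: big1 => i _; rewrite -sumrN -[X in _ + X]sumrN -!big_split/=.
apply: big1 => j _; rewrite -sumrN -[X in _ + X]sumrN -!big_split/=.
apply: big1 => a _; ring.
Qed.

Lemma parallel_inner_derive (c V W : R -> 'rV[R]_n) (t : R) :
  parallel m M g c V -> parallel m M g c W -> 0 <= t <= 1 ->
  is_derive t 1 (fun s => g (c s) (V s) (W s)) 0.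
Proof.
move=> pV pW t01; have [Mct loc] := pV t t01.
have [phi [U [lp ct]]] := hM Mct.
have [u [v uvn]] := loc phi U lp ct.
have [_ /(_ phi U lp ct)[u2 [w uwn]]] := pW t t01.
(* Each field brings its own coordinate curve for [c]; injectivity of the chart identifies the two
   near [t], hence also their velocities. *)
have uu2 : \near t, u2 t = u t.
  apply: filterS2 uvn uwn => s [[Uus cE _] _] [[Uu2s c2E _] _].
  by case: lp => _ _ inj _ _; apply: inj; rewrite ?inE// -c2E -cE.
have [[Uu _ _] [du dv vpar]] := nbhs_singleton uvn.
have [_ [_ dw wpar]] := nbhs_singleton uwn.
have u2E := nbhs_singleton uu2.
have du2E : derive1 u2 t = derive1 u t.
  by rewrite !derive1E; exact: near_eq_derive.
pose F s := \sum_i \sum_j v s 0 i * gram g phi (u s) i j * w s 0 j.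
apply: (@near_eq_is_derive _ _ _ F).
  apply: filterS3 uu2 uvn uwn => s us [[Uus cE VE] _] [[_ _ WE] _].
  by rewrite VE WE cE us (gram_form hg _ _ lp Uus).
pose D a i j := 'D_(coord_vec R a) (fun z => gram g phi z i j) (u t).
have Fd : is_derive t 1 F (\sum_i \sum_j
    (derive1 v t 0 i * gram g phi (u t) i j * w t 0 j
     + v t 0 i * (\sum_a derive1 u t 0 a * D a i j) * w t 0 j
     + v t 0 i * gram g phi (u t) i j * derive1 w t 0 j)).
  apply: is_derive_big => i; apply: is_derive_big => j.
  have dG := is_derive_gram i j lp Uu du.
  have dvi := is_derive_coord i dv; have dwj := is_derive_coord j dw.
  apply: is_derive_eq (is_deriveM (is_deriveM dvi dG) dwj) _.
  rewrite !fctE /= /GRing.scale/=; ring.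
rewrite (@metric_compat _ _ (christoffel g phi (u t))) in Fd => //.
- by move=> i j; exact: gram_sym lp Uu.
- move=> a i j; apply: near_eq_derive.
  have Un : nbhs (u t) U by apply: open_nbhs_nbhs; split=> //; case: lp.
  apply: (@filterS _ _ (nbhs_filter (u t)) U) => // z Uz.
  exact: gram_sym lp Uz.
- by move=> a b j; exact: christoffel_lower lp Uu.
- by move=> k; have := wpar k; rewrite /covariant_derivative du2E u2E.
Qed.

Lemma parallel_inner_const (c V W : R -> 'rV[R]_n) :
  parallel m M g c V -> parallel m M g c W ->
  g (c 0) (V 0) (W 0) = g (c 1) (V 1) (W 1).
Proof.
move=> pV pW; pose F s := g (c s) (V s) (W s).
have dF (t : R) : t \in `[0, 1] -> is_derive t 1 F 0.
  by rewrite in_itv/=; exact: parallel_inner_derive.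
have dFo (t : R) : t \in `]0, 1[ -> is_derive t 1 F 0.
  by move=> t01; apply: dF; exact: subset_itv_oo_cc.
have cF : {within `[0, 1], continuous F}.
  by apply: derivable_within_continuous => t /dF[].
have [z _] := MVT_segment ler01 dFo cF.
by rewrite mul0r => /eqP; rewrite subr_eq0 => /eqP.
Qed.

Lemma parallel_tangent (c V : R -> 'rV[R]_n) (t : R) :
  parallel m M g c V -> 0 <= t <= 1 -> tangent m M (c t) (V t).
Proof.
move=> pV t01; have [Mct loc] := pV t t01; have [phi [U [lp ct]]] := hM Mct.
have [u [v /nbhs_singleton[[Uu -> ->] _]]] := loc phi U lp ct.
by exists phi, U, (u t), (v t).
Qed.

Variable geo : 'rV[R]_n -> 'rV[R]_n -> R -> 'rV[R]_n.
Variable Gam : 'rV[R]_n -> 'rV[R]_n -> 'rV[R]_n -> 'rV[R]_n.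
Hypotheses (hgeo : shortest_geodesics m M g geo)
  (hGam : parallel_transport m M g geo Gam).

Lemma transport_tangent x y v : M x -> M y -> tangent m M x v ->
  tangent m M y (Gam x y v).
Proof.
move=> Mx My tv; have [[_ c1 _] _ _ _] := hgeo Mx My.
have [V [pV _ <-]] := hGam Mx My tv.
by rewrite -[y in tangent _ _ y _]c1; apply: parallel_tangent pV _;
  rewrite ler01 lexx.
Qed.

Lemma transport_isometry x y v w : M x -> M y ->
  tangent m M x v -> tangent m M x w ->
  g y (Gam x y v) (Gam x y w) = g x v w.
Proof.
move=> Mx My tv tw; have [[c0 c1 _] _ _ _] := hgeo Mx My.
have [V [pV V0 V1]] := hGam Mx My tv.
have [W [pW W0 W1]] := hGam Mx My tw.
by have := parallel_inner_const pV pW; rewrite c0 c1 V0 V1 W0 W1.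
Qed.

(** Isometry moves [g z v' w'] to the tangent space at [y]; there bilinearity splits the difference
    and Cauchy-Schwarz bounds both parts. *)
Lemma transport_inner_lipschitz y z v w v' w' : M y -> M z ->
  tangent m M y v -> tangent m M y w -> tangent m M z v' -> tangent m M z w' ->
  `|g y v w - g z v' w'| <= dist_star g Gam y v z v' * rnorm g y w
                            + rnorm g z v' * dist_star g Gam y w z w'.
Proof.
move=> My Mz tv tw tv' tw'.
have tGv := transport_tangent Mz My tv'.
have tGw := transport_tangent Mz My tw'.
have -> : g y v w - g z v' w' =
    g y (v - Gam z y v') w + g y (Gam z y v') (w - Gam z y w').
  rewrite -(transport_isometry Mz My tv' tw').
  by rewrite (metricBl hg)// (metricBr hg)// addrA subrK.
have -> : rnorm g z v' = rnorm g y (Gam z y v').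
  by rewrite /rnorm transport_isometry.
rewrite (le_trans (ler_normD _ _))// lerD//.
  by apply: (cauchy_schwarz hM hg) => //; exact: tangentB.
by apply: (cauchy_schwarz hM hg) => //; exact: tangentB.
Qed.
End Parallel.

(** * Two convergence criteria for real sequences *)

Section Sequences.
Variable R : realType.

Lemma delayed_contraction_cvg0 (K : nat) (q : R) (u a : nat -> R) :
  (0 < K)%N -> 0 <= q < 1 -> (forall k, 0 <= u k) ->
  a k @[k --> \oo] --> (0 : R) ->
  (forall k, u (k + K)%N <= q * u k + a (k + K)%N) ->
  u k @[k --> \oo] --> (0 : R).
Proof.
move=> K0 /andP[q0 q1] u0 a0 uK; apply/cvgrPdist_le => e e0.
(* With errors of this size the level [e / 2] is preserved by the recursion, since
   [q * (e / 2) + (1 - q) * (e / 2) = e / 2]. *)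
have e1 : 0 < (1 - q) * (e / 2) by rewrite mulr_gt0 ?subr_gt0// divr_gt0.
have [N _ aN] : \forall k \near \oo, a k <= (1 - q) * (e / 2).
  move/cvgrPdist_le: a0 => /(_ _ e1); apply: filterS => k.
  by rewrite sub0r normrN; apply: le_trans; exact: ler_norm.
(* [C] dominates the starting values of all [K] residue classes at once; each class then decays
   geometrically down to [e / 2]. *)
pose C := \sum_(r < K) u (N + r)%N.
have C0 : 0 <= C by apply: sumr_ge0.
have blocks i r : (r < K)%N -> u (N + (i * K + r))%N <= e / 2 + C * q ^+ i.
  move=> rK; elim: i => [|i IH].
    rewrite mul0n add0n expr0 mulr1 ler_wpDl//; first by rewrite divr_ge0// ltW.
    by rewrite /C (bigD1 (Ordinal rK))//= lerDl sumr_ge0.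
  have -> : (N + (i.+1 * K + r) = N + (i * K + r) + K)%N by rewrite mulSn; ring.
  have := uK (N + (i * K + r))%N; have := aN (N + (i * K + r) + K)%N.
  rewrite /= -addnA leq_addr => /(_ isT) h1 h2; rewrite exprS.
  have := ler_wpM2l q0 IH; lra.
have e2 : 0 < e / 2 / (C + 1) by rewrite !divr_gt0// ltr_wpDl.
have [J _ qJ] : \forall i \near \oo, q ^+ i <= e / 2 / (C + 1).
  have q1' : `|q| < 1 by rewrite ger0_norm.
  move/cvgrPdist_le: (cvg_expr q1') => /(_ _ e2); apply: filterS => i.
  by rewrite sub0r normrN; apply: le_trans; exact: ler_norm.
exists (N + J * K)%N => // k /= Jk.
rewrite sub0r normrN ger0_norm//.
have Nk : (N <= k)%N by apply: leq_trans Jk; exact: leq_addr.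
rewrite -(subnKC Nk) (divn_eq (k - N) K).
apply: le_trans (blocks _ _ (ltn_pmod _ K0)) _.
have /qJ : (J <= (k - N) %/ K)%N by rewrite leq_divRL// leq_subRL.
move=> /= qi; have : C * q ^+ ((k - N) %/ K) <= (C + 1) * (e / 2 / (C + 1)).
  by apply: ler_pM => //; rewrite ?exprn_ge0// lerDl.
have -> : (C + 1) * (e / 2 / (C + 1)) = e / 2.
  by rewrite mulrC divfK// gt_eqF// ltr_wpDl.
lra.
Qed.

(** [F] is nonincreasing and bounded below, so it converges and its decrements, which dominate
    [gamma * a k ^+ 2], tend to 0. *)
Lemma sufficient_decrease_cvg0 (F a : nat -> R) (b gamma : R) :
  0 < gamma -> (forall k, 0 <= a k) -> (forall k, b <= F k) ->
  (forall k, F k.+1 <= F k - gamma * a k ^+ 2) -> a k @[k --> \oo] --> (0 : R).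
Proof.
move=> gamma0 a0 bF decF.
have cF : cvgn F.
  apply: nonincreasing_is_cvgn.
    apply/nonincreasing_seqP => k; apply: le_trans (decF k) _.
    by rewrite gerBl mulr_ge0 ?sqr_ge0// ltW.
  by exists b => _ [k _ <-].
have dF : F k - F k.+1 @[k --> \oo] --> (0 : R).
  rewrite -(subrr (limn F)); apply: cvgB => //.
  by rewrite cvg_shiftS.
apply/cvgrPdist_le => e e0.
have e2 : 0 < gamma * e ^+ 2 by rewrite mulr_gt0// exprn_gt0.
move/cvgrPdist_le: dF => /(_ _ e2); apply: filterS => k.
rewrite !sub0r !normrN (ger0_norm (a0 k)) => h.
rewrite -ler_sqr ?nnegrE//; last exact: ltW.
rewrite -(ler_pM2l gamma0).
by apply: le_trans h; apply: le_trans (ler_norm _); have := decF k; lra.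
Qed.

End Sequences.

(** * Guarantees of one linesearch call *)

Section Linesearch.
Variables (R : realType) (n : nat).
Variables (f : 'rV[R]_n -> R) (Rt : 'rV[R]_n -> 'rV[R]_n -> 'rV[R]_n).
Variables (gamma gamma1 gamma2 : R).
Hypotheses (hgamma1 : 0 < gamma1 < 1) (hgamma2 : 1 <= gamma2).

(** The case [b = a] is a loop that stops at once; otherwise [b / gamma2] is the last value that
    passed the test. *)
Lemma extrapolation_spec x d a b :
  extrapolation f Rt gamma gamma2 x d a b -> 0 < a ->
  [/\ 0 < b, ~~ sufficient_decrease f Rt gamma x d b &
     b = a \/ sufficient_decrease f Rt gamma x d (b / gamma2)].
Proof.
have g20 : 0 < gamma2 by exact: lt_le_trans hgamma2.
elim=> {a b} [a na a0|a b sa _ IH a0]; first by split=> //; left.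
have [b0 nb bE] := IH (mulr_gt0 g20 a0); split=> //; right.
by case: bE => // ->; rewrite mulrC mulKf// gt_eqF.
Qed.

(** The rejected step [s] is [alpha], that is [gamma1^-1 * ta], after a failure, and the exit value
    of the loop, that is [gamma2 * ta], after a success; the sum of the two factors serves both
    cases. *)
Lemma linesearch_spec alpha x d a ta : Rt x 0 = x -> 0 < alpha ->
  linesearch f Rt gamma gamma1 gamma2 alpha x d (a, ta) ->
  [/\ 0 <= a, 0 < ta, ta <= gamma1 * alpha + a,
     f (Rt x (a *: d)) <= f x - gamma * a ^+ 2 &
     exists2 s, 0 < s <= (gamma1^-1 + gamma2) * ta
       & ~~ sufficient_decrease f Rt gamma x d s].
Proof.
move=> Rx0 alpha0; have [g10 _] := andP hgamma1.
have g20 : 0 < gamma2 by exact: lt_le_trans hgamma2.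
move eqr: (a, ta) => r ls; case: ls eqr => [nd|b sd ex] [-> ->].
  split; rewrite ?mulr_gt0 ?addr0//.
    by rewrite scale0r Rx0 expr0n mulr0 subr0.
  exists alpha => //; rewrite alpha0/= mulrDl mulKf ?gt_eqF//.
  by rewrite lerDl !mulr_ge0// ltW.
have [b0 nb [bE|sb]] := extrapolation_spec ex alpha0.
  by rewrite bE sd in nb.
split; rewrite ?divr_ge0 ?divr_gt0 ?lerDr ?mulr_ge0// ?ltW//.
exists b => //; rewrite b0/= mulrDl [gamma2 * _]mulrC divfK ?gt_eqF//.
by rewrite lerDr mulr_ge0// ?invr_ge0 ?divr_ge0// ltW.
Qed.

End Linesearch.

(** * Cyclic polling and convergence of the gradient norms *)

Lemma cyclic_index_hits (K : nat) (hK : (0 < K)%N) k (j : 'I_K) :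
  exists2 l, (l < K)%N & cyclic_index hK (k + l) = j.
Proof.
exists ((j + (K - k %% K)) %% K)%N; first exact: ltn_pmod.
apply/val_inj => /=; rewrite modnDmr -modnDml addnCA.
rewrite subnKC; last exact/ltnW/ltn_pmod.
by rewrite modnDr modn_small.
Qed.

Theorem theorem3p2 (R : realType) (m n : nat)
  (M : set 'rV[R]_n) (g : 'rV[R]_n -> 'rV[R]_n -> 'rV[R]_n -> R)
  (geo : 'rV[R]_n -> 'rV[R]_n -> R -> 'rV[R]_n)
  (Gam : 'rV[R]_n -> 'rV[R]_n -> 'rV[R]_n -> 'rV[R]_n)
  (f : 'rV[R]_n -> R) (gradf : 'rV[R]_n -> 'rV[R]_n)
  (Rt : 'rV[R]_n -> 'rV[R]_n -> 'rV[R]_n)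
  (Lr L Lf Mf B tau LGam gamma gamma1 gamma2 : R)
  (K : nat) (hK : (0 < K)%N)
  (x : nat -> 'rV[R]_n) (p : nat -> 'I_K -> 'rV[R]_n)
  (alpha talpha : nat -> 'I_K -> R)
  (hM : embedded_manifold m M)
  (hg : riemannian_metric m M g)
  (hgeo : shortest_geodesics m M g geo)
  (hGam : parallel_transport m M g geo Gam)
  (hgrad : riemannian_gradient m M g f gradf)
  (hfC1 : C1_on_manifold m M f)
  (hfbnd : exists b : R, forall y, M y -> b <= f y)
  (hRt : retraction m M Rt)
  (hLr0 : 0 < Lr)
  (hLr : forall y d, M y -> tangent m M y d ->
     geodesic_dist m M g (Rt y d) y <= Lr * rnorm g y d)
  (hL0 : 0 < L)
  (hL : forall y d, M y -> tangent m M y d ->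
     f (Rt y d) <= f y + g y (gradf y) d + L * rnorm g y d ^+ 2)
  (hLf0 : 0 < Lf)
  (hLf : forall y z, M y -> M z ->
     dist_star g Gam y (gradf y) z (gradf z)
       <= Lf * geodesic_dist m M g y z)
  (hMf0 : 0 < Mf)
  (hMf : forall y, M y -> rnorm g y (gradf y) <= Mf)
  (hB0 : 0 < B) (htau0 : 0 < tau)
  (hspan : forall k, positive_spanning m M (x k) (p k))
  (hB : forall k j, rnorm g (x k) (p k j) <= B)
  (htau : forall k r, tangent m M (x k) r ->
     exists j, tau * rnorm g (x k) r <= g (x k) r (p k j))
  (hLGam0 : 0 < LGam)
  (hLGam : forall l k j,
     dist_star g Gam (x l) (p l j) (x k) (p k j)
       <= LGam * geodesic_dist m M g (x l) (x k))
  (hgamma : 0 < gamma) (hgamma1 : 0 < gamma1 < 1) (hgamma2 : 1 <= gamma2)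
  (halg : RDSE_SB f Rt gamma gamma1 gamma2 M hK x p alpha talpha) :
  rnorm g (x k) (gradf (x k)) @[k --> \oo] --> (0 : R).
Proof.
have [Mx0 talpha0 other ls step] := halg.
have [RtM _ Rt0 _] := hRt.
pose j k := cyclic_index hK k.
pose s k := alpha k (j k); pose t k := talpha k.+1 (j k).
have tp k i : tangent m M (x k) (p k i) by case: (hspan k).
have Mx k : M (x k).
  elim: k => // k IH; rewrite step; apply: RtM => //; exact: tangentZ.
have talpha_gt0 k i : 0 < talpha k i.
  elim: k i => // k IH i; have [->|ij] := eqVneq i (j k).
    by have [] := linesearch_spec hgamma1 hgamma2 (Rt0 _ (Mx k)) (IH _) (ls k).
  by have [_ ->] := other k i ij.
have spec k := linesearch_spec hgamma1 hgamma2
  (Rt0 _ (Mx k)) (talpha_gt0 k (j k)) (ls k).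
have tgrad k : tangent m M (x k) (gradf (x k)) by case: (hgrad _ (Mx k)).
have s0 k : 0 <= s k by case: (spec k).
have t0 k : 0 <= t k by case: (spec k) => _ /ltW.
have s_cvg : s k @[k --> \oo] --> (0 : R).
  have [b fb] := hfbnd.
  apply: (@sufficient_decrease_cvg0 _ (f \o x) s b gamma) => // k.
    exact: fb.
  by rewrite /= step; case: (spec k).
have t_step k : t (k + K)%N <= gamma1 * t k + s (k + K)%N.
  have jK : j (k + K)%N = j k by apply/val_inj; rewrite /= modnDr.
  (* The direction polled at [k] is next polled at [k + K]; taking [i = K.-1] shows that it enters
     that poll with tentative stepsize [t k]. *)
  have frozen i : (i < K)%N -> talpha (k.+1 + i)%N (j k) = talpha k.+1 (j k).
    elim: i => [|i IH] iK; first by rewrite addn0.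
    rewrite addnS -(IH (ltnW iK)).
    have jj : j k != j (k.+1 + i)%N.
      rewrite -val_eqE /= addSnnS -[k in (k %% _)%N]addn0 eqn_modDl mod0n.
      by rewrite modn_small.
    by have [_ ->] := other _ _ jj.
  have := frozen K.-1; rewrite prednK// leqnn => /(_ isT) talphaE.
  have [_ _ + _ _] := spec (k + K)%N.
  by rewrite /t /s jK -talphaE addSnnS prednK// -jK.
have t_cvg : t k @[k --> \oo] --> (0 : R).
  apply: (delayed_contraction_cvg0 hK) s_cvg t_step => //.
  by case/andP: hgamma1 => /ltW -> ->.
pose C := (gamma + L * B ^+ 2) * (gamma1^-1 + gamma2).
have C0 : 0 < C.
  rewrite mulr_gt0// addr_gt0// ?mulr_gt0// ?exprn_gt0// ?invr_gt0.
    by case/andP: hgamma1.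
  exact: lt_le_trans hgamma2.
(* The first factor is the Lipschitz constant of the inner product of gradient and direction; the
   second bounds the distance of consecutive iterates per unit of step. *)
pose C2 := (Lf * B + Mf * LGam) * (Lr * B).
have C20 : 0 < C2 by rewrite !mulr_gt0// addr_gt0// mulr_gt0.
pose phi k i := - g (x k) (gradf (x k)) (p k i).
(* At the rejected step [a], failure of the decrease test and the upper model of [f] enclose the
   same value; dividing by [a] bounds [phi] by a multiple of [a], hence of [t k]. *)
have polled k : phi k (j k) <= C * t k.
  have [_ _ _ _ [a /andP[a0 at_] nd]] := spec k.
  have gB0 : 0 < gamma + L * B ^+ 2 by rewrite addr_gt0// mulr_gt0// exprn_gt0.
  rewrite /C -mulrA.
  apply: (@le_trans _ _ ((gamma + L * B ^+ 2) * a)); last first.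
    by rewrite ler_pM2l.
  move: nd; rewrite /sufficient_decrease -ltNge => nd.
  have := hL _ _ (Mx k) (tangentZ a (tp k (j k))).
  rewrite (metricZr hM hg)// (rnormZ hM hg)// (gtr0_norm a0) => hLk.
  have r2 : (a * rnorm g (x k) (p k (j k))) ^+ 2 <= (a * B) ^+ 2.
    rewrite ler_sqr ?nnegrE ?mulr_ge0 ?sqrtr_ge0 ?(ltW a0) ?(ltW hB0)//.
    by rewrite ler_pM2l.
  have := ler_wpM2l (ltW hL0) r2 => {}r2.
  rewrite -(ler_pM2l a0) /phi.
  have := lt_le_trans nd hLk; rewrite -/(j k); lra.
have phi_step k i : phi k i <= phi k.+1 i + C2 * s k.
  have dist_le : geodesic_dist m M g (x k.+1) (x k) <= Lr * B * s k.
    rewrite step; apply: le_trans (hLr _ _ (Mx k) (tangentZ _ (tp k _))) _.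
    rewrite -mulrA ler_pM2l// (rnormZ hM hg)// ger0_norm ?s0// mulrC.
    by rewrite ler_wpM2r// s0.
  (* The new iterate comes first because the retraction bound controls the distance from [Rt y d] to
     [y], in this order. *)
  have := transport_inner_lipschitz hM hg hgeo hGam (Mx k.+1) (Mx k)
    (tgrad k.+1) (tp k.+1 i) (tgrad k) (tp k i).
  set d1 := dist_star _ _ _ (gradf _) _ _.
  set d2 := dist_star _ _ _ (p _ _) _ _.
  have d10 : 0 <= d1 by exact: sqrtr_ge0.
  have d20 : 0 <= d2 by exact: sqrtr_ge0.
  have d1le : d1 <= Lf * (Lr * B * s k).
    by apply: le_trans (hLf _ _ (Mx _) (Mx _)) _; rewrite ler_pM2l.
  have d2le : d2 <= LGam * (Lr * B * s k).
    by apply: le_trans (hLGam _ _ _) _; rewrite ler_pM2l.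
  have := ler_pM d10 (sqrtr_ge0 _) d1le (hB k.+1 i).
  have := ler_pM (sqrtr_ge0 _) d20 (hMf _ (Mx k)) d2le.
  rewrite /phi /C2 /rnorm ler_norml; lra.
have phi_chain k l i :
    phi k i <= phi (k + l)%N i + C2 * \sum_(r < l) s (k + r)%N.
  elim: l => [|l IH]; first by rewrite addn0 big_ord0 mulr0 addr0.
  rewrite big_ord_recr addnS mulrDr; have := phi_step (k + l)%N i; lra.
(* Summing over a whole cycle makes the bound independent of the direction selected and of when it
   is polled. *)
pose bnd k := \sum_(r < K) (C * t (k + r)%N + C2 * s (k + r)%N).
have grad_le k : tau * rnorm g (x k) (gradf (x k)) <= bnd k.
  (* Spanning is applied to the negative gradient, to match the sign in [phi]. *)
  have [i taui] := htau k _ (tangentZ (-1) (tgrad k)).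
  move: taui; rewrite (rnormZ hM hg)// normrN1 mul1r (metricZl hM hg)// mulN1r.
  move=> /le_trans; apply; rewrite -/(phi k i).
  have [l lK il] := cyclic_index_hits hK k i.
  apply: le_trans (phi_chain k l i) _.
  have := polled (k + l)%N; rewrite /j il => phil.
  apply: (@le_trans _ _ (C * t (k + l)%N + C2 * \sum_(r < l) s (k + r)%N)).
    by rewrite lerD2r.
  rewrite /bnd big_split/= -!mulr_sumr lerD// ler_pM2l//.
    by rewrite (bigD1 (Ordinal lK))//= lerDl sumr_ge0.
  rewrite -!(big_mkord xpredT (fun r => s (k + r)%N)).
  by rewrite [leRHS](big_cat_nat (n := l))//= ?(ltnW lK)// lerDl sumr_ge0.
have bnd_cvg : bnd k @[k --> \oo] --> (0 : R).
  have shift (c : R) (u : nat -> R) r : u k @[k --> \oo] --> (0 : R) ->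
      c * u (k + r)%N @[k --> \oo] --> (0 : R).
    by rewrite -(cvg_shiftn r) => /(cvgM (cvg_cst c)); rewrite mulr0.
  have <- : \sum_(r < K) (0 : R) = 0 by rewrite big1.
  apply: cvg_big => [|r _]; first exact: add_continuous.
  have := cvgD (shift C t r t_cvg) (shift C2 s r s_cvg).
  by rewrite addr0; apply.
apply: (@squeeze_cvgr _ _ _ _ (fun=> 0) (fun k => tau^-1 * bnd k)).
- by apply: nearW => k; rewrite sqrtr_ge0 ler_pdivlMl// grad_le.
- exact: cvg_cst.
- by have := cvgM (cvg_cst tau^-1) bnd_cvg; rewrite mulr0; apply.
Qed.
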